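(* Let $G$ be a metrizable topological group and let $T$ be a subset of $G$. The following assertions are equivalent. (i) $T$ is an approximable $\mathcal{LUC}(G)$-interpolation set (respectively, an approximable $\mathcal{RUC}(G)$-interpolation set). (ii) $T$ is an $\mathcal{LUC}(G)$-interpolation set (respectively, an $\mathcal{RUC}(G)$-interpolation set). (iii) $T$ is right (respectively, left) uniformly discrete.
   Context: Let $e$ be the identity of $G$. $\mathcal{LUC}(G)$ (respectively, $\mathcal{RUC}(G)$) is the algebra of bounded $f:G\to\mathbb C$ such that for every $\epsilon>0$ there is a neighbourhood $U$ of $e$ with $|f(s)-f(t)|<\epsilon$ whenever $st^{-1}\in U$ (respectively, $s^{-1}t\in U$). Let $\mathcal A(G)$ be a set of bounded scalar-valued functions on $G$. $T\subseteq G$ is an $\mathcal A(G)$-interpolation set if every bounded $f:T\to\mathbb C$ extends to a function in $\mathcal A(G)$. It is an approximable $\mathcal A(G)$-interpolation set if, in addition, for every neighbourhood $U$ of $e$ there are open neighbourhoods $V_1,V_2$ of $e$ with $\overline{V_1}\subseteq V_2\subseteq U$ such that for each $T_1\subseteq T$ there is $h\in\mathcal A(G)$ with $h(V_1T_1)\subseteq\{1\}$ and $h(G\setminus V_2T_1)\subseteq\{0\}$. $T$ is right (respectively, left) uniformly discrete if there is a neighbourhood $V$ of $e$ with $Vs\cap Vs'=\emptyset$ (respectively, $sV\cap s'V=\emptyset$) for all $s\ne s'$ in $T$.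
   Formalization: For RUC(G), approximability is taken with T_1V_1 and T_1V_2 in place of V_1T_1 and V_2T_1; with the latter, (iii)⇒(i) fails, e.g. for T={(2^n,0)} in the affine group (a,b)(c,d)=(ac,ad+b), a>0. *)

(* Defs.v *)
From HB Require Import structures.
From mathcomp Require Import all_boot all_order all_algebra.
From mathcomp Require Import all_classical all_reals.
From mathcomp Require Import topology.
From mathcomp Require Import complex.

Set Implicit Arguments.
Unset Strict Implicit.
Unset Printing Implicit Defensive.

Import Order.TTheory GRing.Theory Num.Theory.

Local Open Scope classical_set_scope.
Local Open Scope complex_scope.
Local Open Scope ring_scope.

HB.mixin Record isTopologicalGroup G & Topological G & Group G := {
  mulg_continuous : continuous (fun x : G * G => (x.1 * x.2)%g) ;
  invg_continuous : continuous (fun x : G => (x^-1)%g)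
}.

#[short(type="topologicalGroupType")]
HB.structure Definition TopologicalGroup :=
  {G of Topological G & Group G & isTopologicalGroup G}.

Section Defs.
Context {R : realType}.

Definition is_metric (X : Type) (d : X -> X -> R) : Prop :=
  [/\ forall x y, d x y = 0 <-> x = y,
      forall x y, d x y = d y x &
      forall x y z, d x z <= d x y + d y z].

Definition metrizable (X : topologicalType) : Prop :=
  exists d : X -> X -> R, is_metric d /\
    forall (x : X) (A : set X),
      nbhs x A <-> exists2 e : R, 0 < e & [set y | d x y < e] `<=` A.

Definition bounded_function (X : Type) (f : X -> R[i]) : Prop :=
  exists M : R, forall x, `|f x| <= M%:C.

Context {G : topologicalGroupType}.

Definition LUC : set (G -> R[i]) := [set f | bounded_function f /\
  forall eps : R, 0 < eps -> exists2 U, nbhs (1%g : G) U &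
    forall s t : G, U (s * t^-1)%g -> `|f s - f t| < eps%:C].

Definition RUC : set (G -> R[i]) := [set f | bounded_function f /\
  forall eps : R, 0 < eps -> exists2 U, nbhs (1%g : G) U &
    forall s t : G, U (s^-1 * t)%g -> `|f s - f t| < eps%:C].

Definition prodset (A B : set G) : set G :=
  [set (a * b)%g | a in A & b in B].

Definition interpolation_set (A : set (G -> R[i])) (T : set G) : Prop :=
  forall f : T -> R[i], bounded_function f ->
    exists2 g, A g & forall t : T, g (val t) = f t.

(* [mulV V T1] is the thickening of [T1] by the neighbourhood [V] of the
   identity: [V T1] or [T1 V], depending on the side. *)
Definition approximable_with (mulV : set G -> set G -> set G)
    (A : set (G -> R[i])) (T : set G) : Prop :=
  interpolation_set A T /\
  forall U : set G, nbhs (1%g : G) U ->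
    exists V1 V2 : set G,
      [/\ open_nbhs (1%g : G) V1, open_nbhs (1%g : G) V2,
          closure V1 `<=` V2, V2 `<=` U &
          forall T1 : set G, T1 `<=` T -> exists h : G -> R[i],
            [/\ A h, h @` mulV V1 T1 `<=` [set 1] &
                h @` (~` mulV V2 T1) `<=` [set 0]]].

Definition approximable_interpolation_set :=
  approximable_with (fun V T1 => prodset V T1).

(* The mirror image under [x |-> x^-1], which exchanges [LUC] with [RUC] and
   right with left uniform discreteness; this is the version for [RUC]. With
   [V T1] in place of [T1 V], left uniformly discrete sets need not be
   approximable [RUC]-interpolation sets: take the points [(2^n, 0)] of the
   affine group [(a, b) (c, d) = (a c, a d + b)], [a > 0], of the line. *)
Definition approximable_interpolation_set_r :=
  approximable_with (fun V T1 => prodset T1 V).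

Definition right_uniformly_discrete (T : set G) : Prop :=
  exists2 V, nbhs (1%g : G) V &
    forall s s' : G, T s -> T s' -> s <> s' ->
      prodset V [set s] `&` prodset V [set s'] = set0.

Definition left_uniformly_discrete (T : set G) : Prop :=
  exists2 V, nbhs (1%g : G) V &
    forall s s' : G, T s -> T s' -> s <> s' ->
      prodset [set s] V `&` prodset [set s'] V = set0.

End Defs.

Arguments metrizable : clear implicits.
Arguments LUC : clear implicits.
Arguments RUC : clear implicits.

(* Main.v *)
(* A right uniformly discrete set [T] is separated by a right uniformly
   continuous bump function at the identity, so a bounded function on [T] is
   extended by adding up its multiples of the translated bumps. Conversely, if
   [T] is not right uniformly discrete, first countability yields pairs
   [s_n <> t_n] in [T] with [s_n t_n^-1 --> 1], and some set contains every
   [s_n] and no [t_n]; its indicator function on [T] has no uniformly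
   continuous extension. Inversion exchanges the two halves. *)
Require Import Defs.
From HB Require Import structures.
From mathcomp Require Import all_boot all_order all_algebra.
From mathcomp Require Import all_classical all_reals.
From mathcomp Require Import topology.
From mathcomp Require Import complex.
From mathcomp Require Import lra urysohn.

Set Implicit Arguments.
Unset Strict Implicit.
Unset Printing Implicit Defensive.

Import Order.TTheory GRing.Theory Num.Theory.

Local Open Scope classical_set_scope.
Local Open Scope complex_scope.
Local Open Scope ring_scope.

(** * Neighbourhoods of the identity *)

Section TopologicalGroupTheory.
Context {G : topologicalGroupType}.
Implicit Types (x y : G) (U : set G).

Lemma nbhs1_mul U : nbhs (1%g : G) U ->
  exists2 V, nbhs (1%g : G) V & forall x y, V x -> V y -> U (x * y)%g.
Proof.
move=> nU; have := @mulg_continuous G (1, 1)%g U.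
rewrite /= mulg1 => /(_ nU) [[A B] /= [nA nB] AB].
exists (A `&` B); first exact: filterI.
by move=> x y [Ax _] [_ By]; exact: (AB (x, y)).
Qed.

Lemma nbhs1_inv U : nbhs (1%g : G) U -> nbhs (1%g : G) [set x | U x^-1%g].
Proof.
by move=> nU; have := @invg_continuous G 1%g U; rewrite /= invg1; exact.
Qed.

Lemma mulgr_continuous y : continuous (fun x : G => (x * y)%g).
Proof.
move=> x; apply: (@continuous_comp _ _ _ (fun z : G => (z, y))
  (fun p : G * G => (p.1 * p.2)%g)).
  by apply: cvg_pair; [exact: cvg_id | exact: cvg_cst].
exact: mulg_continuous.
Qed.

Lemma nbhs_mulgV x U :
  nbhs (1%g : G) U -> nbhs x [set y | U (y * x^-1)%g].
Proof. by move=> nU; apply: mulgr_continuous; rewrite mulgV. Qed.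

Lemma nbhs1_mulg x A : nbhs x A -> nbhs (1%g : G) [set u | A (u * x)%g].
Proof. by move=> nA; apply: mulgr_continuous; rewrite mul1g. Qed.

Lemma nbhs1_mulVg U : nbhs (1%g : G) U ->
  exists2 V, nbhs (1%g : G) V & forall x y, V x -> V y -> U (x^-1 * y)%g.
Proof.
move=> /nbhs1_mul [V nV VU].
exists ([set x | V x^-1%g] `&` V); first by apply: filterI => //; exact: nbhs1_inv.
by move=> x y [Vx _] [_ Vy]; exact: VU.
Qed.

End TopologicalGroupTheory.

(** * The right uniformity, carried by an alias of [G] *)

Definition right_uniform_space (G : Type) : Type := G.

Section RightUniformSpace.
Context {G : topologicalGroupType}.
Local Notation X := (right_uniform_space G).

(** With closeness measured by [y x^-1], [LUC] consists of the bounded uniformly continuous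
    functions. *)
Definition right_entourage : set_system (X * X) :=
  [set E | exists2 U, nbhs (1%g : G) U &
    forall x y : G, U (y * x^-1)%g -> E (x, y)].

Lemma right_entourage_filter : Filter right_entourage.
Proof.
split.
- by exists setT => //; exact: filterT.
- move=> E F [U nU UE] [V nV VF]; exists (U `&` V); first exact: filterI.
  by move=> x y [Uxy Vxy]; split; [exact: UE | exact: VF].
- by move=> E F EF [U nU UE]; exists U => // x y /UE /EF.
Qed.

Local Open Scope relation_scope.

Lemma right_entourage_diagonal E : right_entourage E -> diagonal `<=` E.
Proof.
move=> [U nU UE] [x y] /diagonalP <-; apply: UE; rewrite mulgV.
exact: nbhs_singleton nU.
Qed.

Lemma right_entourage_inv E : right_entourage E -> right_entourage E^-1.
Proof.
move=> [U nU UE]; exists [set x | U x^-1%g]; first exact: nbhs1_inv.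
by move=> x y /=; rewrite invgM invgK => /UE.
Qed.

Lemma right_entourage_split E : right_entourage E ->
  exists2 F, right_entourage F & F \; F `<=` E.
Proof.
move=> [U nU UE]; have [V nV VU] := nbhs1_mul nU.
exists [set p : X * X | V ((p.2 : G) * (p.1 : G)^-1)%g]; first by exists V.
move=> [x z] [y] /= Vxy Vyz; apply: UE.
by have := VU _ _ Vyz Vxy; rewrite mulgA mulgVK.
Qed.

HB.instance Definition _ := Topological.copy X G.

(** Right translation by [x] matches neighbourhoods of the identity with neighbourhoods of [x]. *)
Lemma nbhs_right_entourage : @nbhs X X = nbhs_ right_entourage.
Proof.
apply/funext => x; apply/seteqP; split => A.
  move=> nA; exists [set p : X * X | A ((p.2 : G) * (p.1 : G)^-1 * (x : G))%g].
    by exists [set u | A (u * (x : G))%g]; first exact: nbhs1_mulg nA.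
  by move=> y /xsectionP /=; rewrite mulgVK.
move=> [E [U nU UE] EA]; apply: filterS (nbhs_mulgV (x : G) nU) => y Uyx.
by apply: EA; apply/xsectionP; exact: UE.
Qed.

HB.instance Definition _ := Nbhs_isUniform_mixin.Build X
  right_entourage_filter right_entourage_diagonal right_entourage_inv
  right_entourage_split nbhs_right_entourage.

End RightUniformSpace.

(** * Right uniformly continuous norms and bumps *)

Section RightUniformContinuity.
Context {R : realType} {G : topologicalGroupType}.

Definition right_unif_continuous (N : G -> R) : Prop :=
  forall e : R, 0 < e -> exists2 W, nbhs (1%g : G) W &
    forall x y : G, W (x * y^-1)%g -> `|N x - N y| < e.

(* The gauge of the entourage [{(x, y) | y x^-1 \in U}] is a pseudometric
   coarser than the right uniformity; [N] is a multiple of its distance to the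
   identity. *)
Lemma exists_right_unif_continuous_norm (U : set G) : nbhs (1%g : G) U ->
  exists N : G -> R, [/\ N 1%g = 0, forall y, N y < 1 -> U y &
    right_unif_continuous N].
Proof.
move=> nU.
pose X : uniformType := right_uniform_space G.
pose E : set (X * X) := [set p | U ((p.2 : G) * (p.1 : G)^-1)%g].
have entE : @entourage X E by exists U.
pose P : pseudoMetricType R := gauge.type entE.
have [r r0 rU] : exists2 r : R, 0 < r &
    forall y : P, ball (1%g : P) r y -> U y.
  (* The chain of entourages that generates the gauge starts with the intersection of [E] and its
     inverse. *)
  have : @entourage P E by exists 0%N => // p [].
  rewrite -entourage_ballE => -[r /= r0 rE]; exists r => // y /(rE (1%g, y)).
  by rewrite /E /= invg1 mulg1.
(* Balls of radius 2 in [P] are the whole space, so all distances are finite. *)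
have fin (p : P * P) : edist p \is a fin_num.
  apply/edist_finP; exists 2 => //.
  exact: countable_uniform.countable_uniform_bounded.
pose d (x y : P) : R := fine (edist (x, y)).
have d_tri x y z : d x z <= d x y + d y z.
  by rewrite -fineD// fine_le ?fin_numD ?fin// edist_triangle.
have d_sym x y : d x y = d y x by rewrite /d edist_sym.
exists (fun y => d 1%g y / r); split.
- by rewrite /d edist_refl mul0r.
- move=> y; rewrite ltr_pdivrMr// mul1r => dr; apply: rU.
  by apply: (@edist_lt_ball _ _ _ (_, _)); rewrite -[edist _]fineK ?fin// lte_fin.
(* The half restores strictness: a ball of radius [e'] only gives a distance at most [e']. *)
move=> e e0; pose e' := e * r / 2.
have e'0 : 0 < e' by rewrite divr_gt0// mulr_gt0.
have : @entourage P [set p | ball p.1 e' p.2] by rewrite -entourage_ballE; exists e' => // -[].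
move=> /(gauge.gauge_ent entE) [W nW WE].
exists W => // x y /WE /= yx.
have dyx : d y x <= e'.
  by rewrite -lee_fin fineK ?fin//; exact: edist_fin.
have He : e' < e * r by rewrite ltr_pdivrMr// ltr_pMr ?mulr_gt0// ltr1n.
rewrite -mulrBl normrM (gtr0_norm (_ : 0 < r^-1)) ?invr_gt0//.
rewrite ltr_pdivrMr// (le_lt_trans _ He)// ler_norml.
have := d_tri 1%g y x; have := d_tri 1%g x y; rewrite (d_sym x y).
by move=> h1 h2; apply/andP; split; lra.
Qed.

Lemma right_unif_continuous_near (N : G -> R) (x : G) (e : R) :
  right_unif_continuous N -> 0 < e -> \forall y \near x, `|N y - N x| < e.
Proof.
move=> uN /uN[W nW WN].
by apply: filterS (nbhs_mulgV x nW) => y; exact: WN.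
Qed.

Lemma right_unif_continuous_open_lt (N : G -> R) (c : R) :
  right_unif_continuous N -> open [set x | N x < c].
Proof.
move=> uN; rewrite openE => x /= Nx.
apply: filterS (right_unif_continuous_near x uN (_ : 0 < c - N x)).
  by move=> y /=; rewrite ltr_norml => /andP[_]; lra.
by rewrite subr_gt0.
Qed.

Lemma right_unif_continuous_closure_lt (N : G -> R) (b c : R) :
  right_unif_continuous N -> b < c ->
  closure [set x | N x < b] `<=` [set x | N x < c].
Proof.
move=> uN bc x /(_ [set y | `|N y - N x| < c - b]) [].
  by apply: right_unif_continuous_near => //; rewrite subr_gt0.
by move=> y /= [Ny]; rewrite ltr_norml => /andP[]; lra.
Qed.

(* Equal to 1 on [N <= 1/4] and to 0 on [1/2 <= N]. *)
Definition bump (N : G -> R) (x : G) : R := Num.max 0 (Num.min 1 (2 - 4 * N x)).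

(** Truncation to [[0, 1]] does not expand distances, so the slope 4 of [2 - 4 * N x] is a Lipschitz
    constant. *)
Lemma bump_lipschitz (N : G -> R) (x y : G) :
  `|bump N x - bump N y| <= 4 * `|N x - N y|.
Proof.
rewrite /bump ler_norml.
have := ler_norm (N x - N y); have := ler_norm (N y - N x).
rewrite (distrC (N y)); set a := `|N x - N y| => h1 h2.
case: (lerP 1 (2 - 4 * N x)) => ?; case: (lerP 1 (2 - 4 * N y)) => ?;
  rewrite ?(max_r (@ler01 R)); try case: (lerP 0 (2 - 4 * N x)) => ?;
  try case: (lerP 0 (2 - 4 * N y)) => ?; apply/andP; split; lra.
Qed.

Lemma bump_right_unif_continuous (N : G -> R) :
  right_unif_continuous N -> right_unif_continuous (bump N).
Proof.
move=> uN e e0; have [|W nW WN] := uN (e / 4); first by rewrite divr_gt0.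
exists W => // x y /WN h; apply: le_lt_trans (bump_lipschitz N x y) _; lra.
Qed.

End RightUniformContinuity.

Section ComplexValued.
Context {R : realType}.

Lemma normc_real (a : R) : `|a%:C| = `|a|%:C.
Proof. by rewrite normc_def /= expr0n addr0 sqrtr_sqr. Qed.

End ComplexValued.

(** * From right uniform discreteness to interpolation *)

Section Interpolation.
Context {R : realType} {G : topologicalGroupType}.
Implicit Types (S T V : set G) (x y s t : G).

Lemma prodsetP V S x :
  prodset V S x <-> exists2 t, S t & V (x * t^-1)%g.
Proof.
split=> [[v Vv [t St <-]]|[t St Vxt]]; first by exists t; rewrite // mulgK.
by exists (x * t^-1)%g => //; exists t => //; rewrite mulgVK.
Qed.

Lemma prodsetVP V S x :
  prodset S V x <-> exists2 t, S t & V (t^-1 * x)%g.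
Proof.
split=> [[t St [v Vv <-]]|[t St Vxt]]; first by exists t; rewrite // mulKg.
by exists t => //; exists (t^-1 * x)%g => //; rewrite mulVKg.
Qed.

(** Trades functions on the subtype [T] for total functions, extending by 0 off [T]. *)
Lemma interpolation_setP (A : set (G -> R[i])) T : interpolation_set A T <->
  forall f : G -> R[i], bounded_function f ->
    exists2 g, A g & forall t, T t -> g t = f t.
Proof.
split=> AT f [M fM].
  have [|g Ag gf] := AT (f \o val); first by exists M => t; exact: fM.
  by exists g => // t Tt; exact: (gf (exist _ t (mem_set Tt))).
pose F x := if insub x is Some t then f t else 0.
have [|g Ag gF] := AT F; last first.
  by exists g => // t; rewrite gF /F ?valK//; exact/set_mem/valP.
(* If [T] is empty, [M] may be negative, while the default value 0 needs a nonnegative bound. *)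
exists (Num.max M 0) => x; rewrite /F; case: insub => [t|].
  by rewrite (le_trans (fM t))// lecR le_max lexx.
by rewrite normr0 ler0c le_max lexx orbT.
Qed.

Lemma right_uniformly_discreteP T : right_uniformly_discrete T <->
  exists2 V, nbhs (1%g : G) V & forall s t x, T s -> T t ->
    V (x * s^-1)%g -> V (x * t^-1)%g -> s = t.
Proof.
split=> -[V nV VT]; exists V => // s t.
  move=> x Ts Tt Vxs Vxt; apply: contrapT => /(VT _ _ Ts Tt).
  by apply/eqP/set0P; exists x; split; apply/prodsetP; [exists s | exists t].
move=> Ts Tt st; rewrite -subset0 => x [/prodsetP[_ -> xs] /prodsetP[_ -> xt]].
exact/st/(VT s t x).
Qed.

Lemma left_uniformly_discreteP T : left_uniformly_discrete T <->
  exists2 V, nbhs (1%g : G) V & forall s t x, T s -> T t ->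
    V (s^-1 * x)%g -> V (t^-1 * x)%g -> s = t.
Proof.
split=> -[V nV VT]; exists V => // s t.
  move=> x Ts Tt Vxs Vxt; apply: contrapT => /(VT _ _ Ts Tt).
  by apply/eqP/set0P; exists x; split; apply/prodsetVP; [exists s | exists t].
move=> Ts Tt st; rewrite -subset0 => x [/prodsetVP[_ -> xs] /prodsetVP[_ -> xt]].
exact/st/(VT s t x).
Qed.

(* [g] is [\sum_(t in S) f t * bump N (x t^-1)]; at most one term is nonzero. *)
Lemma LUC_bump_sum (N : G -> R) S (f : G -> R[i]) :
  right_unif_continuous N -> bounded_function f ->
  (forall s t x, S s -> S t ->
    N (x * s^-1)%g < 1 -> N (x * t^-1)%g < 1 -> s = t) ->
  exists g, [/\ LUC R G g,
    forall t x, S t -> N (x * t^-1)%g < 1 / 4 -> g x = f t &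
    forall x, (forall t, S t -> ~ N (x * t^-1)%g < 1 / 2) -> g x = 0].
Proof.
move=> uN [M fM] inj.
have M0 : 0 <= M by rewrite -ler0c (le_trans _ (fM 1%g)).
pose near x t := S t /\ N (x * t^-1)%g < 1 / 2.
(* The only possibly nonzero term is picked by choice; [inj] makes the pick unique, and 0 is the
   empty sum. *)
pose g x := if pselect (exists t, near x t) is left h
  then f (sval (cid h)) * (bump N (x * (sval (cid h))^-1)%g)%:C else 0.
have bump0 y : ~ N y < 1 / 2 -> bump N y = 0.
  by move=> /negP; rewrite -leNgt /bump => ?; apply: max_l; rewrite ge_min; lra.
have bump1 y : N y < 1 / 4 -> bump N y = 1.
  by move=> ?; rewrite /bump min_l ?max_r//; lra.
have bump_ge0 y : 0 <= bump N y by rewrite le_max lexx.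
have bump_le1 y : bump N y <= 1 by rewrite ge_max ler01 ge_min lexx.
have g_near x t : near x t -> g x = f t * (bump N (x * t^-1)%g)%:C.
  move=> [St xt]; rewrite /g; case: pselect => [h|[]]; last by exists t.
  case: (cid h) => s [/= Ss xs].
  by rewrite (inj s t x Ss St _ _)//; lra.
have g_far x : (forall t, ~ near x t) -> g x = 0.
  by move=> xN; rewrite /g; case: pselect => // h; have [t /xN] := h.
exists g; split.
- split=> [|e e0].
    exists M => x; rewrite /g; case: pselect => [h|_]; last first.
      by rewrite normr0 ler0c.
    rewrite normrM normc_real -[M%:C]mulr1 ler_pM// ?lecR//.
    by rewrite ger0_norm// -[1]/(1%:C) lecR.
  (* This gives [M * d < e / 2], also when [M = 0]; the half is there because two terms may
     contribute. *)
  pose d := e / 2 / (M + 1).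
  have d0 : 0 < d by rewrite !divr_gt0// ltr_wpDl.
  have [W nW WN] := bump_right_unif_continuous uN d0.
  exists W => // x y Wxy.
  (* One [W] serves all [t], since [(x t^-1) (y t^-1)^-1 = x y^-1]. *)
  have close t : `|f t * (bump N (x * t^-1)%g)%:C -
                   f t * (bump N (y * t^-1)%g)%:C| < (e / 2)%:C.
    rewrite -mulrBr normrM -rmorphB normc_real.
    have bd : `|bump N (x * t^-1)%g - bump N (y * t^-1)%g| <= d.
      by apply/ltW/WN; rewrite mulgKA.
    apply: (@le_lt_trans _ _ (M%:C * d%:C)); first by rewrite ler_pM// lecR.
    rewrite -rmorphM ltcR /d mulrCA -[ltRHS]mulr1 ltr_pM2l ?divr_gt0//.
    by rewrite ltr_pdivrMr ?mul1r ?ltrDl// ltr_wpDl.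
  have e2 : (e / 2)%:C < e%:C by rewrite ltcR; lra.
  have zero z t : ~ near z t -> S t -> f t * (bump N (z * t^-1)%g)%:C = 0.
    by move=> zt St; rewrite bump0 ?mulr0// => zt'; exact: zt.
  (* If no point is near both [x] and [y], each nonzero value is compared with its own term at the
     other argument, which vanishes. *)
  have [[s xs]|xN] := pselect (exists s, near x s); last first.
    rewrite (g_far x); last by move=> t xt; apply: xN; exists t.
    have [[t yt]|yN] := pselect (exists t, near y t); last first.
      rewrite (g_far y) ?subrr ?normr0 ?ltcR// => t yt.
      by apply: yN; exists t.
    rewrite (g_near _ _ yt) -(zero x t) ?(lt_trans (close t))//.
    - by move=> xt; apply: xN; exists t.
    - by case: yt.
  have [ys|yns] := pselect (near y s).
    by rewrite (g_near _ _ xs) (g_near _ _ ys) (lt_trans (close s)).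
  have gx : `|g x| < (e / 2)%:C.
    by have := close s; rewrite -(g_near _ _ xs) (zero y)// ?subr0//; case: xs.
  have [[t yt]|yN] := pselect (exists t, near y t); last first.
    rewrite (g_far y) ?subr0 ?(lt_trans gx)// => t yt.
    by apply: yN; exists t.
  have gy : `|g y| < (e / 2)%:C.
    have := close t; rewrite -(g_near _ _ yt) (zero x) ?sub0r ?normrN//.
      move=> xt; apply: yns; rewrite (inj s t x)//; case: xs xt => ? ? [? ?] //; lra.
    by case: yt.
  rewrite (le_lt_trans (ler_normB _ _))//.
  by rewrite [e]splitr rmorphD ltrD.
- by move=> t x St xt; rewrite (g_near x t) ?bump1 ?mulr1//; split => //; lra.
- by move=> x xN; apply: g_far => t [/xN].
Qed.

Lemma right_uniformly_discrete_LUC T : right_uniformly_discrete T ->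
  approximable_interpolation_set (LUC R G) T.
Proof.
move=> /right_uniformly_discreteP[V nV VT]; split.
  have [N [N1 NV uN]] := @exists_right_unif_continuous_norm R G _ nV.
  apply/interpolation_setP => f bf.
  have [|g [Lg gf _]] := @LUC_bump_sum N T f uN bf.
    by move=> s t x Ts Tt /NV xs /NV; exact: VT xs.
  by exists g => // t Tt; apply: gf => //; rewrite mulgV N1 divr_gt0.
move=> U nU.
have [N [N1 NVU uN]] := @exists_right_unif_continuous_norm R G _ (filterI nV nU).
(* The bump is 1 on the first set and 0 off the second, so the sum over [T1] with coefficients 1
   will serve as [h]. *)
exists [set x | N x < 1 / 4], [set x | N x < 1 / 2]; split.
- split; last by rewrite /= N1 divr_gt0.
  exact: right_unif_continuous_open_lt.
- split; last by rewrite /= N1 divr_gt0.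
  exact: right_unif_continuous_open_lt.
- by apply: right_unif_continuous_closure_lt => //; lra.
- by move=> x /= Nx; have [] : (V `&` U) x by apply: NVU; lra.
move=> T1 T1T; have [| |h [Lh h1 h0]] := @LUC_bump_sum N T1 (cst 1) uN.
- by exists 1 => x; rewrite normr1.
- move=> s t x /T1T Ts /T1T Tt /NVU[xs _] /NVU[xt _]; exact: VT xs xt.
exists h; split => // _ [x + <-].
  by move=> /prodsetP[t T1t xt]; exact: h1 xt.
by move=> xN; apply: h0 => t T1t xt; apply: xN; apply/prodsetP; exists t.
Qed.

(** * From interpolation to right uniform discreteness *)

(** An extension of the indicator of [A] varies by less than 1 between close points, whereas the
    values 0 and 1 are at distance exactly 1. *)
Lemma LUC_interpolation_separates T (A : set G) :
  interpolation_set (LUC R G) T ->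
  exists2 U, nbhs (1%g : G) U &
    forall s t, T s -> T t -> U (s * t^-1)%g -> A s <-> A t.
Proof.
move=> /interpolation_setP /(_ (fun x => (x \in A)%:R)) [].
  by exists 1 => x; case: (_ \in _); rewrite /= ?normr1// normr0 ler0c.
move=> g [_ /(_ 1 ltr01)[U nU Ug]] gA; exists U => // s t Ts Tt /Ug.
rewrite !gA//; have [As|As] := boolP (s \in A); have [At|At] := boolP (t \in A);
  rewrite /= ?subr0 ?sub0r ?normrN ?normr1 ?ltxx// => _.
  by split=> _; exact: set_mem.
by split=> /mem_set; apply: contraTP.
Qed.

(** Separating the singleton of [a] keeps two distinct close points of [T] both different from [a];
    finitely many such neighbourhoods are intersected. *)
Lemma LUC_interpolation_avoid T (l : seq G) :
  interpolation_set (LUC R G) T ->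
  exists2 U, nbhs (1%g : G) U & forall s t, T s -> T t -> s <> t ->
    U (s * t^-1)%g -> s \notin l /\ t \notin l.
Proof.
move=> iT; elim: l => [|a l [U nU Ul]]; first by exists setT; [exact: filterT|].
have [V nV Va] := LUC_interpolation_separates [set a] iT.
exists (U `&` V); first exact: filterI.
move=> s t Ts Tt st [/(Ul _ _ Ts Tt st)[sl tl] /(Va _ _ Ts Tt) /= sta].
rewrite !inE !negb_or sl tl !andbT; split; apply/eqP => ea; apply: st.
  by rewrite ea (sta.1 ea).
by rewrite ea (sta.2 ea).
Qed.

Lemma metrizable_countable_nbhs_base x : metrizable R G ->
  exists2 B : nat -> set G, forall n, nbhs x (B n) &
    forall U, nbhs x U -> exists n, B n `<=` U.
Proof.
move=> [d [_ dP]]; exists (fun n => [set y | d x y < n.+1%:R^-1]) => [n|U].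
  by apply/dP; exists n.+1%:R^-1; rewrite // invr_gt0.
move=> /dP[e /ltr_add_invr[n]]; rewrite add0r => ne eU; exists n => y /= xy.
exact/eU/(lt_trans xy).
Qed.

(* Interpolation of indicators of points lets [s_n], [t_n] be chosen outside the
   finite list [l n] of the previous points; hence no [t_m] is an [s_n]. *)
Lemma LUC_interpolation_right_uniformly_discrete T : metrizable R G ->
  interpolation_set (LUC R G) T -> right_uniformly_discrete T.
Proof.
move=> mG iT; apply: contrapT => /right_uniformly_discreteP Tnd.
have pairs U : nbhs (1%g : G) U ->
    exists s t, [/\ T s, T t, s <> t & U (s * t^-1)%g].
  (* A common point [x] of two translates of [V] gives [s t^-1 = (x s^-1)^-1 (x t^-1)], which lies
     in [U]. *)
  move=> /nbhs1_mulVg[V nV VU]; apply: contrapT => NU; apply: Tnd; exists V => //.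
  move=> s t x Ts Tt Vxs Vxt; apply: contrapT => st; apply: NU.
  exists s, t; split => //.
  by have := VU _ _ Vxs Vxt; rewrite invgM invgK -mulgA mulKg.
have [B nB BU] := metrizable_countable_nbhs_base 1%g mG.
pose good (ln : seq G * nat) (p : G * G) :=
  [/\ T p.1, T p.2, B ln.2 (p.1 * p.2^-1)%g &
      [/\ p.1 <> p.2, p.1 \notin ln.1 & p.2 \notin ln.1]].
have /choice[c cP] : forall ln, exists p, good ln p.
  move=> [l n]; have [U nU Ul] := LUC_interpolation_avoid l iT.
  have [s [t [Ts Tt st [Bst Ust]]]] := pairs _ (filterI (nB n) nU).
  by exists (s, t); have [] := Ul _ _ Ts Tt st Ust.
(* [c] answers every history and index, so the recursion only has to record the pairs chosen so
   far. *)
pose l := fix l n :=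
  if n is m.+1 then (c (l m, m)).1 :: (c (l m, m)).2 :: l m else [::].
pose s n := (c (l n, n)).1; pose t n := (c (l n, n)).2.
have l_mono m n : (m <= n)%N -> {subset l m <= l n}.
  move=> /subnK <-; elim: (n - m)%N => // k IH y /IH yl.
  by rewrite addSn /= !inE yl !orbT.
have sl m n : (m < n)%N -> s m \in l n.
  by move=> mn; apply: (l_mono m.+1) => //; rewrite inE eqxx.
have tl m n : (m < n)%N -> t m \in l n.
  by move=> mn; apply: (l_mono m.+1) => //; rewrite !inE eqxx orbT.
(* Once [B n] lies in [U], the point [t n] must share membership in [range s] with [s n], hence
   equals some [s m]. *)
have [U nU Us] := LUC_interpolation_separates (range s) iT.
have [n BnU] := BU _ nU.
have [Tsn Ttn Bn [st _ tn]] := cP (l n, n).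
have [|m _ mn] := (Us _ _ Tsn Ttn (BnU _ Bn)).1; first by exists n.
have {}mn : s m = t n by [].
(* Whichever of [s m] and [t n] was chosen later had to avoid the other; for [m = n] the pair is
   distinct. *)
have [lt_mn|lt_nm|eq_mn] := ltngtP m n.
- by move: tn; rewrite -[(c (l n, n)).2]/(t n) -mn /= sl.
- have [_ _ _ [_ sm _]] := cP (l m, m).
  by move: sm; rewrite -[(c (l m, m)).1]/(s m) mn /= tl.
- by apply: st; rewrite -[LHS]/(s n) -[RHS]/(t n) -mn eq_mn.
Qed.

End Interpolation.

(** * Exchange of left and right by inversion *)

Section Inversion.
Context {R : realType} {G : topologicalGroupType}.
Implicit Types (T : set G).

(** At the inverted arguments, the quotient [s^-1 t] of [RUC] becomes [s t^-1]. *)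
Lemma RUC_LUC (f : G -> R[i]) : RUC R G f <-> LUC R G (fun x => f x^-1%g).
Proof.
split=> -[[M fM] uf]; split.
- by exists M => x; exact: fM.
- move=> e /uf[U nU Uf]; exists U => // s t st.
  by apply: Uf; rewrite invgK.
- by exists M => x; have := fM x^-1%g; rewrite invgK.
- move=> e /uf[U nU Uf]; exists U => // s t st.
  by have := Uf s^-1%g t^-1%g; rewrite !invgK; exact.
Qed.

Lemma RUC_interpolation_inv T : interpolation_set (RUC R G) T ->
  interpolation_set (LUC R G) [set x | T x^-1%g].
Proof.
move=> /interpolation_setP iT; apply/interpolation_setP => f [M fM].
have [|g /RUC_LUC Lg gf] := iT (fun x => f x^-1%g).
  by exists M => x; exact: fM.
by exists (fun x => g x^-1%g) => // t Tt; rewrite gf// invgK.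
Qed.

Lemma LUC_approximable_inv T :
  approximable_interpolation_set (LUC R G) [set x | T x^-1%g] ->
  approximable_interpolation_set_r (RUC R G) T.
Proof.
have inv_RUC (g : G -> R[i]) : LUC R G g -> RUC R G (fun x => g x^-1%g).
  by move=> Lg; apply/RUC_LUC; under eq_fun do rewrite invgK.
have open_inv (V : set G) : open_nbhs (1%g : G) V ->
    open_nbhs (1%g : G) [set x | V x^-1%g].
  move=> [oV V1]; split; last by rewrite /= invg1.
  by apply: open_comp oV => x _; exact: invg_continuous.
(* Inversion reverses products: [(V S^-1)^-1 = S V^-1], which moves the thickening to the right. *)
have prod_inv (V S : set G) x :
    prodset V [set t | S t^-1%g] x^-1%g <-> prodset S [set v | V v^-1%g] x.
  split=> [/prodsetP[t St Vt]|/prodsetVP[t St Vt]].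
    by apply/prodsetVP; exists t^-1%g; rewrite //= invgM invgK.
  apply/prodsetP; exists t^-1%g; rewrite /= ?invgK//.
  by move: Vt; rewrite /= invgM invgK.
move=> [/interpolation_setP iT aT]; split.
  apply/interpolation_setP => f [M fM].
  have [|g Lg gf] := iT (fun x => f x^-1%g); first by exists M => x; exact: fM.
  exists (fun x => g x^-1%g); first exact: inv_RUC.
  by move=> t Tt; rewrite gf /= invgK.
(* [U] is inverted first so that the inverse of [V2] lands in [U]. *)
move=> U /nbhs1_inv /aT[V1 [V2 [oV1 oV2 V12 V2U H]]].
exists [set x | V1 x^-1%g], [set x | V2 x^-1%g]; split.
- exact: open_inv.
- exact: open_inv.
- move=> x clx; apply: V12 => A /(@invg_continuous G)/clx[y [V1y Ay]].
  by exists y^-1%g.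
- by move=> x /V2U /=; rewrite invgK.
move=> T1 T1T; have [|h [Lh h1 h0]] := H [set x | T1 x^-1%g].
  by move=> x /T1T.
exists (fun x => h x^-1%g); split; first exact: inv_RUC.
  by move=> _ [x /prod_inv Vx <-]; apply: h1; exists x^-1%g.
move=> _ [x Vx <-]; apply: h0; exists x^-1%g => //.
by move=> /prod_inv.
Qed.

Lemma left_uniformly_discrete_inv T :
  left_uniformly_discrete T <-> right_uniformly_discrete [set x | T x^-1%g].
Proof.
split=> [/left_uniformly_discreteP|/right_uniformly_discreteP] [V nV VT];
  [apply/right_uniformly_discreteP|apply/left_uniformly_discreteP];
  (exists [set x | V x^-1%g]; first exact: nbhs1_inv); move=> s t x /= Ts Tt;
  rewrite !invgM ?invgK => Vs Vt; apply: invg_inj.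
  by apply: (VT _ _ x^-1%g); rewrite ?invgK.
by apply: (VT _ _ x^-1%g); rewrite /= ?invgK.
Qed.

End Inversion.

(** * The two cycles of implications *)

Theorem theorem4p9 (R : realType) (G : topologicalGroupType)
    (Gmetrizable : metrizable R G) (T : set G) :
  [<-> approximable_interpolation_set (LUC R G) T;
       interpolation_set (LUC R G) T;
       right_uniformly_discrete T]
  /\
  [<-> approximable_interpolation_set_r (RUC R G) T;
       interpolation_set (RUC R G) T;
       left_uniformly_discrete T].
Proof.
split; tfae.
- by case.
- exact: LUC_interpolation_right_uniformly_discrete.
- exact: right_uniformly_discrete_LUC.
- by case.
- move=> /RUC_interpolation_inv iT; apply/left_uniformly_discrete_inv.
  exact: LUC_interpolation_right_uniformly_discrete Gmetrizable iT.
- move=> /left_uniformly_discrete_inv Td; apply: LUC_approximable_inv.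
  exact: right_uniformly_discrete_LUC.
Qed.
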